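(* Let $c:(\mathbb R^d)^n\to\mathbb R$ be differentiable and locally Lipschitz, and let $\mu_1,\dots,\mu_n$ be Borel probability measures on $\mathbb R^d$ with bounded and regular supports: for each $i$ there is a bounded connected open set $O_i\subset\mathbb R^d$ with $\mu_i(O_i)=1$ and $\mu_i(\partial O_i)=0$. Suppose that each $\mu_i$ is absolutely continuous with respect to the $d$-dimensional Lebesgue measure $\mathcal L^d$ and has a positive density with respect to $\mathcal L^d$ on $O_i$. Then $(DK)$ admits a unique solution up to the addition of constants summing to $0$ to the potentials; that is, $(DK)$ has a solution, and if $(\varphi_1,\dots,\varphi_n)$ and $(\psi_1,\dots,\psi_n)$ are two solutions, then there are constants $a_1,\dots,a_n\in\mathbb R$ with $\sum_{i=1}^n a_i=0$ such that $\psi_i=\varphi_i+a_i$ $\mu_i$-a.e. for every $i\in\{1,\dots,n\}$.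
   Context: The dual problem $(DK)$ is \[\sup\Big\{\sum_{i=1}^n\int_{\mathbb R^d}\varphi_i\,d\mu_i;\ (\varphi_1,\dots,\varphi_n)\in K_c\Big\},\] where $K_c$ is the set of $n$-tuples of Borel measurable functions $\varphi_i:\mathbb R^d\to[-\infty,\infty)$ such that $c(x_1,\dots,x_n)\ge\sum_{i=1}^n\varphi_i(x_i)$ for all $(x_1,\dots,x_n)\in(\mathbb R^d)^n$; the supremum is over those $n$-tuples for which the sum of integrals is well defined. A solution of $(DK)$ is an $n$-tuple attaining the supremum. $\partial O$ denotes the topological boundary of $O$. *)

(* Defs.v *)
From HB Require Import structures.
From mathcomp Require Import all_boot all_order all_algebra.
From mathcomp Require Import all_classical all_reals all_analysis.
From mathcomp Require Import measurable_realfun.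

Set Implicit Arguments.
Unset Strict Implicit.
Unset Printing Implicit Defensive.

Import Order.TTheory GRing.Theory Num.Theory.
Import numFieldNormedType.Exports.

Local Open Scope classical_set_scope.
Local Open Scope ring_scope.

Fact borel_display : measure_display.
Proof. exact: default_measure_display. Qed.

Section borel_rV.
Context {R : realType} {d : nat}.

HB.instance Definition _ := @isMeasurable.Build borel_display 'rV[R]_d
  <<s @open 'rV[R]_d >> (@sigma_algebra0 _ setT _) (@sigma_algebraC _ _)
  (@sigma_algebra_bigcup _ setT _).

Lemma measurable_rVE :
  @measurable _ 'rV[R]_d = <<s @open 'rV[R]_d >>.
Proof. by []. Qed.

Lemma open_measurable_rV (U : set 'rV[R]_d) : open U -> measurable U.
Proof. exact: sub_sigma_algebra. Qed.

Lemma measurable_coord_rV (i : 'I_d) :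
  measurable_fun [set: 'rV[R]_d] (fun v => v ord0 i : R).
Proof.
apply: (measurability _ (RGenOpens.measurableE R)) => _ [_ [a [b ->] <-]].
rewrite setTI; apply: open_measurable_rV; apply: open_comp => //.
by move=> v _; exact: coord_continuous.
Qed.

Lemma measurable_fun_rVP d' (T : measurableType d') (f : T -> 'rV[R]_d) :
  (forall i, measurable_fun setT (fun t => f t ord0 i : R)) ->
  measurable_fun setT f.
Proof.
move=> mf; apply: (measurability _ measurable_rVE) => _ [U oU <-].
rewrite setTI.
pose B (p : 'rV[rat]_d * nat) : set 'rV[R]_d :=
  ball (map_mx ratr p.1 : 'rV[R]_d) (p.2.+1%:R^-1 : R).
pose G p := if `[< B p `<=` U >] then f @^-1` (B p) else set0.
have -> : f @^-1` U = \bigcup_p G p.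
  apply/seteqP; split=> [t /= Uft|t [p _]]; last first.
    by rewrite /G; case: asboolP => // BU /BU.
  have /nbhs_ballP[e /= e0 eU] : nbhs (f t) U by exact: open_nbhs_nbhs.
  have [k ke] : exists k : nat, k.+1%:R^-1 < e / 2.
    have e20 : 0 < e / 2 by rewrite divr_gt0.
    exists (Num.truncn (e / 2)^-1).
    by rewrite invf_plt ?posrE// truncnS_gt.
  have k0 : 0 < k.+1%:R^-1 :> R by rewrite invr_gt0.
  have /choice[q qP] : forall i : 'I_d, exists q : rat,
      ball (ratr q : R) k.+1%:R^-1 (f t ord0 i).
    move=> i.
    have [x [/= xB [q _ qx]]] := @dense_rat R (ball (f t ord0 i : R) k.+1%:R^-1)
      (ex_intro _ _ (ballxx _ k0)) (ball_open _ _).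
    by exists q; rewrite qx; exact: ball_sym.
  have Bt : B (\row_i q i, k) (f t).
    by split=> // i j; rewrite !mxE (ord1 i).
  exists (\row_i q i, k) => //; rewrite /G; case: asboolP => // -[] y By.
  apply: eU; rewrite [e]splitr.
  apply: (@ball_triangle _ _ (map_mx ratr (\row_i q i) : 'rV[R]_d)).
    apply: le_ball (ball_sym Bt); exact: ltW.
  by apply: le_ball By; exact: ltW.
apply: countable_bigcupT_measurable => [|p]; first exact: countableP.
rewrite /G.
case: asboolP => // _.
rewrite [X in measurable X](_ : _ = \big[setI/setT]_(i < d)
    ((fun t => f t ord0 i : R) @^-1` ball (ratr (p.1 ord0 i) : R) p.2.+1%:R^-1)).
  apply: bigsetI_measurable => i _; rewrite -[X in measurable X]setTI.
  apply: mf => //; apply: open_measurable; exact: ball_open.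
rewrite -bigcap_seq; apply/seteqP; split=> t /=.
  by move=> [_ tB] i _ /=; have := tB ord0 i; rewrite mxE.
move=> tB; split=> // i j; rewrite mxE (ord1 i).
by apply: tB => /=; rewrite mem_index_enum.
Qed.

End borel_rV.

Section lebesgue_rV.
Local Open Scope ereal_scope.
Context {R : realType}.

Definition cons_rV d (p : measurableTypeR R * 'rV[R]_d) : 'rV[R]_d.+1 :=
  row_mx (p.1)%:M p.2.

Definition uncons_rV d (v : 'rV[R]_d.+1) : measurableTypeR R * 'rV[R]_d :=
  (v ord0 ord0, @rsubmx R 1 1 d v).

Lemma cons_rV0 d (p : measurableTypeR R * 'rV[R]_d) :
  cons_rV p ord0 ord0 = p.1.
Proof.
transitivity (row_mx (p.1)%:M p.2 ord0 (lshift d ord0)).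
  by congr fun_of_matrix; exact: val_inj.
by rewrite row_mxEl mxE eqxx.
Qed.

Lemma cons_rVS d (p : measurableTypeR R * 'rV[R]_d) (i : 'I_d) :
  cons_rV p ord0 (lift ord0 i) = p.2 ord0 i.
Proof.
transitivity (row_mx (p.1)%:M p.2 ord0 (rshift 1 i)); last by rewrite row_mxEr.
by congr fun_of_matrix; exact: val_inj.
Qed.

Lemma cons_rVK d : cancel (@cons_rV d) (@uncons_rV d).
Proof.
move=> p; rewrite /uncons_rV cons_rV0 /cons_rV row_mxKr.
by case: p.
Qed.

Lemma uncons_rVK d : cancel (@uncons_rV d) (@cons_rV d).
Proof.
move=> v; apply/rowP => i; case: (unliftP ord0 i) => [j ->|->].
  by rewrite cons_rVS /= mxE; congr fun_of_matrix; exact: val_inj.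
by rewrite cons_rV0.
Qed.

Lemma measurable_cons_rV d : measurable_fun setT (@cons_rV d).
Proof.
apply: measurable_fun_rVP => i; case: (unliftP ord0 i) => [j ->|->].
  under eq_fun do rewrite cons_rVS.
  apply: (@measurableT_comp _ _ _ _ _ _ (fun v : 'rV[R]_d => v ord0 j)) => //.
  exact: measurable_coord_rV.
under eq_fun do rewrite cons_rV0.
exact: measurable_fst.
Qed.

Lemma measurable_uncons_rV d : measurable_fun setT (@uncons_rV d).
Proof.
apply/measurable_fun_pairP; split; first exact: measurable_coord_rV.
apply: measurable_fun_rVP => i /=.
under eq_fun do rewrite mxE.
exact: measurable_coord_rV.
Qed.

Section step.
Context (d : nat) (m : {sigma_finite_measure set 'rV[R]_d -> \bar R}).

Definition lebesgue_rVS : set 'rV[R]_d.+1 -> \bar R :=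
  pushforward (lebesgue_measure \x m) (@cons_rV d).

Let mcons := @measurable_cons_rV d.

Let lebesgue_rVS0 : lebesgue_rVS set0 = 0.
Proof. exact: measure0. Qed.

Let lebesgue_rVS_ge0 A : 0 <= lebesgue_rVS A.
Proof. exact: measure_ge0. Qed.

Let lebesgue_rVS_sigma_additive : semi_sigma_additive lebesgue_rVS.
Proof. exact: measure_semi_sigma_additive. Qed.

HB.instance Definition _ := isMeasure.Build _ _ _ lebesgue_rVS
  lebesgue_rVS0 lebesgue_rVS_ge0 lebesgue_rVS_sigma_additive.

Let lebesgue_rVS_sigma_finite : sigma_finite setT lebesgue_rVS.
Proof.
have /sigma_finiteP[F [TF ndF Foo]] := sigma_finiteT (@lebesgue_measure R).
have /sigma_finiteP[G [TG ndG Goo]] := sigma_finiteT m.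
exists (fun k => @uncons_rV d @^-1` (F k `*` G k)).
  rewrite -preimage_bigcup (_ : \bigcup_k _ = setT) ?preimage_setT//.
  apply/seteqP; split=> // -[x y] _.
  have [k _ Fx] : (\bigcup_k F k) x by rewrite -TF.
  have [l _ Gy] : (\bigcup_k G k) y by rewrite -TG.
  exists (maxn k l) => //; split => /=.
  - by move: x Fx; exact/subsetPset/ndF/leq_maxl.
  - by move: y Gy; exact/subsetPset/ndG/leq_maxr.
move=> k; have [? ?] := Foo k; have [? ?] := Goo k; split.
  rewrite -[X in measurable X]setTI; apply: measurable_uncons_rV => //.
  exact: measurableX.
rewrite /lebesgue_rVS /pushforward -comp_preimage.
rewrite (_ : _ \o _ = id); last by apply/funext => p; exact: cons_rVK.
by rewrite preimage_id product_measure1E// lte_mul_pinfty// ge0_fin_numE.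
Qed.

HB.instance Definition _ := Measure_isSigmaFinite.Build _ _ _ lebesgue_rVS
  lebesgue_rVS_sigma_finite.

End step.

(* Lebesgue measure on R^d, built by the recursion
   L^(d+1) = L^1 (x) L^d along R x R^d ~ R^(d+1). *)
Fixpoint lebesgue_rV (d : nat) :
    {sigma_finite_measure set 'rV[R]_d -> \bar R} :=
  if d is d'.+1 then lebesgue_rVS (lebesgue_rV d') else \d_(0%R : 'rV[R]_0).

Lemma lebesgue_rV_box (d : nat) (A : 'I_d -> set R) :
  (forall i, measurable (A i)) ->
  lebesgue_rV d [set v | forall i, A i (v ord0 i)] =
  \big[*%E/1]_(i < d) lebesgue_measure (A i).
Proof.
elim: d A => [|d IH] A mA.
  rewrite big_ord0 /= diracE mem_set//= => -[] //.
rewrite big_ord_recl -IH; last by move=> i; exact: mA.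
rewrite /= /lebesgue_rVS /pushforward -product_measure1E.
- congr (_ \x _); apply/seteqP; split=> [p /= Ap|p [/= A0 AS] i].
    split=> [|i] /=; first by rewrite -(cons_rV0 p); exact: Ap.
    by rewrite -(cons_rVS p); exact: Ap.
  by case: (unliftP ord0 i) => [j ->|->]; rewrite ?cons_rVS ?cons_rV0.
- exact: mA.
rewrite [X in measurable X](_ : _ = \big[setI/setT]_(i < d)
    ((fun v : 'rV[R]_d => v ord0 i : R) @^-1` A (lift ord0 i))).
  apply: bigsetI_measurable => i _; rewrite -[X in measurable X]setTI.
  by apply: measurable_coord_rV.
rewrite -bigcap_seq; apply/seteqP; split=> v /= Av; first by move=> i _; exact: Av.
by move=> i; apply: (Av i); rewrite /= mem_index_enum.
Qed.

End lebesgue_rV.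

Definition boundary (T : topologicalType) (A : set T) : set T :=
  closure A `\` A°.

Definition locally_lipschitz (R : realType) (V W : normedModType R)
    (f : V -> W) : Prop :=
  forall x : V, exists2 U : set V, nbhs x U & [lipschitz f y | y in U].

Section density.
Local Open Scope ereal_scope.
Context (d : measure_display) (T : measurableType d) (R : realType).

Definition is_density (mu nu : set T -> \bar R) (f : T -> R) : Prop :=
  [/\ measurable_fun setT f, (forall x, (0 <= f x)%R) &
      forall A, measurable A -> mu A = \int[nu]_(x in A) (f x)%:E].

(* The integral of f exists in [-oo, +oo]. *)
Definition integral_defined (mu : set T -> \bar R) (f : T -> \bar R) : Prop :=
  \int[mu]_x f^\+ x < +oo \/ \int[mu]_x f^\- x < +oo.

End density.

Section dual_problem.
Local Open Scope ereal_scope.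
Context (R : realType) (n d : nat).
Variables (c : 'M[R]_(n, d) -> R) (mu : 'I_n -> probability 'rV[R]_d R).
Implicit Types phi : 'I_n -> 'rV[R]_d -> \bar R.

(* A point (x_1, ..., x_n) of (R^d)^n is the n x d matrix with rows x_i. *)
Definition Kc : set ('I_n -> 'rV[R]_d -> \bar R) :=
  [set phi | [/\ forall i, measurable_fun setT (phi i),
                 forall i x, phi i x < +oo &
                 forall x, \sum_(i < n) phi i (row i x) <= (c x)%:E]].

Definition dual_sum phi : \bar R := \sum_(i < n) \int[mu i]_x phi i x.

(* In \bar R the sum +oo + -oo is totalised, hence the second condition. *)
Definition dual_sum_defined phi : Prop :=
  (forall i, integral_defined (mu i) (phi i)) /\
  ~ (exists i j, \int[mu i]_x phi i x = +oo /\ \int[mu j]_x phi j x = -oo).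

Definition DK_feasible : set ('I_n -> 'rV[R]_d -> \bar R) :=
  [set phi | Kc phi /\ dual_sum_defined phi].

Definition DK_value : \bar R := ereal_sup [set dual_sum phi | phi in DK_feasible].

Definition DK_solution phi : Prop := DK_feasible phi /\ dual_sum phi = DK_value.

End dual_problem.

(* Main.v *)
Require Import Defs.
From HB Require Import structures.
From mathcomp Require Import all_boot all_order all_algebra.
From mathcomp Require Import all_classical all_reals all_analysis.
From mathcomp Require Import measurable_realfun lra.

Set Implicit Arguments.
Unset Strict Implicit.
Unset Printing Implicit Defensive.

Import Order.TTheory GRing.Theory Num.Theory.
Import numFieldNormedType.Exports.

Local Open Scope classical_set_scope.
Local Open Scope ring_scope.

(**
The cost [c] is Lipschitz on the relevant compact set and agrees there with a
globally Lipschitz [C].  Replacing the components of a feasible tuple one at a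
time by their [C]-conjugates gives a larger tuple of [L]-Lipschitz potentials, so
the supremum may be taken over those.

Existence: normalise a maximizing sequence of Lipschitz potentials and take its
pointwise limit along an ultrafilter on [nat]; the convergence is uniform on the
compact closures of the [O i].

Uniqueness, without optimal plans or almost everywhere differentiability: if
[u] and [w] are optimal Lipschitz potentials, so is their mean, and every
[x0] in [O i] is the [i]-th row of some [x] where the mean saturates the
constraint.  Then [u] and [w] saturate it at [x] too, so [u i] and [w i] have the
partial derivative of [c] at [x] as a common supergradient at [x0].  Two continuous
functions on a segment that have a common supergradient at every point differ
by a constant, hence [u i - w i] is locally constant on the connected set [O i].
*)

(** * Supergradients on an interval *)

(** The number [p] lies in the Frechet superdifferential of [f] at [t]. *)
Definition supergradient (R : realType) (f : R -> R) (t p : R) : Prop :=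
  forall e, 0 < e -> \forall s \near t, f s - f t <= p * (s - t) + e * `|s - t|.

(* [q = (a, b, r)] encodes the interval ]a, b[ and the slope r. *)
Definition strict_max_on (R : realType) (f : R -> R) (q : rat * rat * rat)
    (t : R) : Prop :=
  [/\ ratr q.1.1 < t, t < ratr q.1.2 &
   forall s, ratr q.1.1 < s -> s < ratr q.1.2 -> s != t ->
     f s - ratr q.2 * s < f t - ratr q.2 * t].

Lemma strict_max_on_uniq (R : realType) (f : R -> R) q (t t' : R) :
  strict_max_on f q t -> strict_max_on f q t' -> t = t'.
Proof.
move=> [a1 b1 m1] [a2 b2 m2]; apply/eqP/negP => /negP tt'.
have := m1 _ a2 b2; rewrite eq_sym => /(_ tt') h1.
by have := lt_trans h1 (m2 _ a1 b1 tt'); rewrite ltxx.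
Qed.

(** Take for [t] the largest point of [[0, 1]] where [k] is at least [y]: a value above [y] at [t]
    would persist just to its right. *)
Lemma last_level_point (R : realType) (k : R -> R) (y : R) :
  continuous k -> k 1 < y < k 0 ->
  exists t, [/\ 0 <= t, t < 1, k t = y & forall s, t < s -> s <= 1 -> k s < y].
Proof.
move=> kc /andP[k1 k0].
pose S : set R := `[0, 1] `&` k @^-1` [set x | y <= x].
have Sc : compact S.
  apply: compact_closedI; first exact: segment_compact.
  by apply: preimage_closed => [x _|]; [exact: kc | exact: closed_ge].
have S0 : S !=set0.
  by exists 0; split=> /=; [rewrite in_itv/= lexx ler01 | exact: ltW].
have [t /set_mem[/= + yt] tmax] := @compact_EVT_max _ R (fun x : R => x) _ S0 Sc
  (@continuous_subspaceT _ _ _ _ (fun x => @cvg_id _ _)).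
rewrite in_itv/= => /andP[t0 t1].
have t1' : t < 1.
  by rewrite lt_neqAle t1 andbT; apply: contraTneq yt => ->; rewrite -ltNge.
have above s : t < s -> s <= 1 -> k s < y.
  move=> ts s1; rewrite ltNge; apply/negP => ys.
  have /tmax : s \in S.
    by apply/mem_set; split => //=; rewrite in_itv/= s1 (le_trans t0 (ltW ts)).
  by rewrite leNgt ts.
exists t; split=> //; apply/eqP; rewrite eq_le yt andbT leNgt; apply/negP => ykt.
have : \forall s \near t^'+, y < k s.
  have H0 : \forall s \near t, y < k s by exact: (cvgr_gt _ (kc t)).
  exact: cvg_within H0.
move=> H; have [s [ks [ts s1]]] : exists s, y < k s /\ (t < s /\ s <= 1).
  near (t^'+) => s; exists s; split; first by near: s.
  by split; [near: s; exact: nbhs_right_gt | apply: ltW; near: s; exact: nbhs_right_lt].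
by have := above s ts s1; rewrite ltNge (ltW ks).
Unshelve. all: by end_near. Qed.

(** The slope [r] lies slightly below [p]. Left of [t] the supergradient of [f] suffices. Right of
    [t], [f - g] drops at rate [eta], so the supergradient of [g] keeps the growth of [f] below
    slope [p - 3 * eta / 4], hence below [r]. *)
Lemma supergradient_strict_max (R : realType) (f g : R -> R) (t p eta : R) :
  0 < eta -> t < 1 -> supergradient f t p -> supergradient g t p ->
  (forall s, t < s -> s <= 1 -> (f s - g s) - (f t - g t) < - eta * (s - t)) ->
  exists q, strict_max_on f q t.
Proof.
move=> eta0 t1 pf pg hs.
have e4 : 0 < eta / 4 by rewrite divr_gt0.
have e8 : 0 < eta / 8 by rewrite divr_gt0.
have [r /andP[r1 r2]] : exists r : rat, p - eta / 2 < ratr r < p - eta / 4.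
  have lt : p - eta / 2 < p - eta / 4 by lra.
  by have [r rI] := rat_in_itvoo lt; exists r; move: rI; rewrite in_itv/=.
have : \forall s \near t, s != t -> f s - ratr r * s < f t - ratr r * t.
  near=> s => st.
  have fs : f s - f t <= p * (s - t) + eta / 8 * `|s - t| by near: s; exact: pf.
  have gs : g s - g t <= p * (s - t) + eta / 4 * `|s - t| by near: s; exact: pg.
  have s1 : s < 1 by near: s; exact: lt_nbhsl.
  move: st; rewrite neq_lt => /orP[st|ts].
    move: fs; rewrite ltr0_norm ?subr_lt0// => fs.
    have : 0 < (p - eta / 8 - ratr r) * (t - s) by rewrite mulr_gt0//; lra.
    nra.
  move: gs; rewrite gtr0_norm ?subr_gt0// => gs.
  have := hs s ts (ltW s1).
  have : 0 <= (ratr r - (p - eta / 2)) * (s - t) by rewrite mulr_ge0//; lra.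
  have : 0 < (s - t) * eta by rewrite mulr_gt0// subr_gt0.
  nra.
move=> /nbhs_ballP[d /= d0 Hd].
have [a /andP[a1 a2]] : exists r : rat, t - d < ratr r < t.
  have lt : t - d < t by lra.
  by have [a rI] := rat_in_itvoo lt; exists a; move: rI; rewrite in_itv/=.
have [b /andP[b1 b2]] : exists r : rat, t < ratr r < t + d.
  have lt : t < t + d by lra.
  by have [b rI] := rat_in_itvoo lt; exists b; move: rI; rewrite in_itv/=.
exists (a, b, r); split=> //= s as_ sb; apply: Hd => /=.
rewrite /ball/= ltr_norml; apply/andP; split; lra.
Unshelve. all: by end_near. Qed.

(* Zygmund's argument: were [f 1 - g 1 < f 0 - g 0], uncountably many levels of
   [f - g + eta * id] would be left for the last time at points where, for some
   rational [r], [f - r * id] has a strict local maximum; these are countably many. *)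
Lemma common_supergradient_le (R : realType) (f g : R -> R) :
  continuous f -> continuous g ->
  (forall t, 0 <= t <= 1 -> exists2 p, supergradient f t p & supergradient g t p) ->
  f 0 - g 0 <= f 1 - g 1.
Proof.
move=> fc gc fg; rewrite leNgt; apply/negP => h10.
(* Half of the drop of [f - g], so that adding [eta * t] still leaves [k 1 < k 0]. *)
pose eta := (f 0 - g 0 - (f 1 - g 1)) / 2.
have eta0 : 0 < eta by rewrite divr_gt0// subr_gt0.
pose k t := f t - g t + eta * t.
have kc : continuous k.
  move=> t; apply: cvgD; first by apply: cvgB; [exact: fc|exact: gc].
  by apply: cvgM; [exact: cvg_cst|exact: cvg_id].
have k10 : k 1 < k 0 by rewrite /k /eta; lra.
have key y : exists qt : (rat * rat * rat) * R,
    k 1 < y < k 0 -> k qt.2 = y /\ strict_max_on f qt.1 qt.2.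
  have [yI|yI] := boolP (k 1 < y < k 0); last by exists ((0, 0, 0), 0).
  have [t [t0 t1 kt ht]] := last_level_point kc yI.
  have [p pf pg] : exists2 p, supergradient f t p & supergradient g t p.
    by apply: fg; rewrite t0 ltW.
  have [|q fq] := supergradient_strict_max eta0 t1 pf pg.
    move=> s ts s1; have := ht s ts s1; rewrite -kt /k; lra.
  by exists (q, t).
have [Q QP] := choice key.
have : countable `]k 1, k 0[%classic.
  apply/countable_injP.
  (* A code determines its point by [strict_max_on_uniq], and the point determines its level through
     [k]. *)
  have inj : {in `]k 1, k 0[%classic &, injective (fun y => pickle (Q y).1)}.
    move=> y z /set_mem; rewrite /= in_itv/= => /QP[ky my] /set_mem.
    rewrite /= in_itv/= => /QP[kz mz] /(pcan_inj pickleK) qyz.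
    by rewrite -ky -kz; congr k; apply: (strict_max_on_uniq my); rewrite qyz.
  by exists (fun y => pickle (Q y).1).
move=> /countable_lebesgue_measure0.
rewrite lebesgue_measure_itv/= lte_fin k10 => /eqP; rewrite eqe; apply/negP.
by rewrite gt_eqF// subr_gt0.
Qed.

(** * Lipschitz functions *)

Definition lipschitz_with (R : realType) (V : normedModType R) (L : R) (f : V -> R) : Prop :=
  forall x y, `|f x - f y| <= L * `|x - y|.

Lemma lipschitz_with_continuous (R : realType) (V : normedModType R) (L : R) (f : V -> R) :
  lipschitz_with L f -> continuous f.
Proof.
move=> fL x; apply/cvgrPdist_le => e e0.
have L0 : 0 < `|L| + 1 by rewrite ltr_wpDl.
near=> y; apply: le_trans (fL x y) _.
apply: (@le_trans _ _ ((`|L| + 1) * `|x - y|)).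
  by rewrite ler_wpM2r// (le_trans (ler_norm L))// lerDl.
rewrite mulrC -ler_pdivlMr//; near: y.
by apply: cvgr_dist_le; rewrite ?divr_gt0.
Unshelve. all: by end_near. Qed.

(** A lower bound of the family at the single point [x0] spreads to every point by the Lipschitz
    property, so the pointwise infimum is finite. It serves for McShane's extension and for the
    [C]-conjugates. *)
Lemma lipschitz_inf (R : realType) (I : Type) (V : normedModType R) (A : set I)
    (F : I -> V -> R) (L : R) (x0 : V) (m0 : R) :
  A !=set0 -> (forall a, A a -> lipschitz_with L (F a)) ->
  (forall a, A a -> m0 <= F a x0) ->
  exists u, [/\ lipschitz_with L u, forall a x, A a -> u x <= F a x &
                forall x m, (forall a, A a -> m <= F a x) -> m <= u x].
Proof.
move=> [a0 Aa0] FL Fm.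
pose u x := inf [set F a x | a in A].
have S0 x : [set F a x | a in A] !=set0 by exists (F a0 x), a0.
have lb x : has_lbound [set F a x | a in A].
  exists (m0 - L * `|x - x0|) => _ [a Aa <-].
  by have := Fm a Aa; have := FL a Aa x x0; rewrite ler_norml => /andP[]; lra.
have uF a x : A a -> u x <= F a x by move=> Aa; apply: ge_inf => //; exists a.
have uM x m : (forall a, A a -> m <= F a x) -> m <= u x.
  by move=> mF; apply: lb_le_inf => // _ [a Aa <-]; exact: mF.
have half x y : u x - L * `|x - y| <= u y.
  apply: uM => a Aa; have := uF _ x Aa.
  by have := FL a Aa x y; rewrite ler_norml => /andP[]; lra.
exists u; split=> // x y; rewrite ler_norml.
have := half x y; have := half y x; rewrite (distrC y x) => h1 h2.
by apply/andP; split; lra.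
Qed.

(** McShane's formula: the infimum over [y] in [K] of [c y + L * |x - y|]. *)
Lemma lipschitz_extension (R : realType) (V : normedModType R) (K : set V)
    (c : V -> R) (L : R) : K !=set0 -> 0 <= L ->
  (forall x y, K x -> K y -> `|c x - c y| <= L * `|x - y|) ->
  exists2 C, lipschitz_with L C & forall x, K x -> C x = c x.
Proof.
move=> [x0 Kx0] L0 cL.
have [|y Ky|y Ky|u [uL uF uM]] :=
    @lipschitz_inf R V V K (fun y x => c y + L * `|x - y|) L x0 (c x0).
- by exists x0.
- move=> a b; rewrite opprD addrACA subrr add0r -mulrBr normrM (ger0_norm L0).
  apply: ler_wpM2l => //; apply: le_trans (ler_dist_dist _ _) _.
  by rewrite opprB addrA subrK.
- by have := cL _ _ Kx0 Ky; rewrite ler_norml => /andP[_]; lra.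
exists u => // x Kx; apply/eqP; rewrite eq_le; apply/andP; split.
  by have := uF _ x Kx; rewrite subrr normr0 mulr0 addr0.
apply: uM => y Ky; have := cL _ _ Kx Ky; rewrite ler_norml => /andP[_]; lra.
Qed.

(** Near a diagonal pair of points of [K] a local constant works; near an off-diagonal pair
    [|c x - c y|] is bounded and [|x - y|] is bounded away from 0. Compactness of the product gives
    one constant for all pairs. *)
Lemma locally_lipschitz_compact (R : realType) (V : normedModType R) (K : set V)
    (c : V -> R) : locally_lipschitz c -> continuous c -> compact K ->
  exists2 L, 0 <= L & forall x y, K x -> K y -> `|c x - c y| <= L * `|x - y|.
Proof.
move=> cL cc cK.
have /compact_near_coveringP cKK := compact_setX cK cK.
have [L0 [_ LP]] : \forall L \near +oo, K `*` K `<=`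
    [set p | `|c p.1 - c p.2| <= L * `|p.1 - p.2|].
  apply: (cKK _ _ (fun L p => `|c p.1 - c p.2| <= L * `|p.1 - p.2|)) => -[x y] _.
  have [<-|xy] := eqVneq x y.
    have [U Ux [M [_ MU]]] := cL x.
    exists (U `*` U, [set L | M < L]) => /=.
      split; last by exists M; split; rewrite ?num_real.
      by exists (U, U).
    by move=> [[a b] L] [[Ua Ub] /= ML]; exact: (MU _ ML (a, b)).
  pose r := `|x - y| / 2; pose T := `|c x - c y| + 1.
  have r0 : 0 < r by rewrite divr_gt0// normr_gt0 subr_eq0.
  have near1 : \forall p \near (x, y), r < `|p.1 - p.2|.
    have f : `|p.1 - p.2| @[p --> (x, y)] --> `|x - y|.
      apply: cvg_norm; apply: cvgB; [exact: cvg_fst|exact: cvg_snd].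
    by apply: (cvgr_gt _ f); rewrite /r ltr_pdivrMr// ltr_pMr ?ltr1n// normr_gt0 subr_eq0.
  have near2 : \forall p \near (x, y), `|c p.1 - c p.2| < T.
    have f : `|c p.1 - c p.2| @[p --> (x, y)] --> `|c x - c y|.
      apply: cvg_norm; apply: cvgB.
      - by apply: (@cvg_comp _ _ _ fst c _ (nbhs x)); [exact: cvg_fst|exact: cc].
      - by apply: (@cvg_comp _ _ _ snd c _ (nbhs y)); [exact: cvg_snd|exact: cc].
    by apply: (cvgr_lt _ f); rewrite /T ltrDl.
  exists ([set p | r < `|p.1 - p.2| /\ `|c p.1 - c p.2| < T], [set L | T / r < L]) => /=.
    split; last by exists (T / r); split; rewrite ?num_real.
    exact: filterI.
  move=> [[a b] L] /= [[rp Tp] TL]; apply: le_trans (ltW Tp) _.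
  move: TL; rewrite ltr_pdivrMr// => TL; apply: le_trans (ltW TL) _.
  have L0 : 0 <= L.
    rewrite -(pmulr_lge0 _ r0); apply: le_trans (ltW TL).
    by rewrite addr_ge0.
  by apply: ler_wpM2l => //; exact: ltW.
exists (`|L0| + 1); first by rewrite addr_ge0.
move=> x y Kx Ky; apply: (LP (`|L0| + 1) _ (x, y)) => //.
by rewrite (le_lt_trans (ler_norm L0))// ltrDl.
Qed.

Lemma nonexpansive_continuous (R : realType) (V W : normedModType R) (f : V -> W) :
  (forall x y, `|f x - f y| <= `|x - y|) -> continuous f.
Proof.
move=> f1 x; apply/cvgrPdist_le => e e0; near=> y.
by apply: le_trans (f1 x y) _; near: y; exact: cvgr_dist_le.
Unshelve. all: by end_near. Qed.

Lemma continuous_sumr (R : realType) (V : normedModType R) (I : finType) (f : I -> V -> R) :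
  (forall i, continuous (f i)) -> continuous (fun x => \sum_i f i x).
Proof.
move=> fc x; apply: (@cvg_big _ _ +%R) => [|i _]; first exact: add_continuous.
exact: fc.
Qed.

(** * Rows of matrices and compact sets of matrices *)

Section matrix_rows.
Context {R : realType} {n d : nat}.
Implicit Types (x y : 'M[R]_(n, d)) (v w : 'rV[R]_d) (i j : 'I_n).

Lemma ler_mx_norm (m k : nat) (x : 'M[R]_(m, k)) (e : R) :
  0 <= e -> (forall (i : 'I_m) (j : 'I_k), `|x i j| <= e) -> `|x| <= e.
Proof.
move=> e0 xe; rewrite /Num.norm/= mx_normrE; apply/bigmax_leP; split => // -[i j] _.
Qed.

Lemma mx_norm_entry (m k : nat) (x : 'M[R]_(m, k)) (i : 'I_m) (j : 'I_k) : `|x i j| <= `|x|.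
Proof.
rewrite [leRHS]/Num.norm/= mx_normrE.
by apply: (le_trans _ (@le_bigmax _ _ _ _ _ (i, j))).
Qed.

Definition set_row x i v : 'M[R]_(n, d) :=
  \matrix_(k, l) if k == i then v ord0 l else x k l.

Lemma row_set_row x i v : row i (set_row x i v) = v.
Proof. by apply/rowP => l; rewrite !mxE eqxx. Qed.

Lemma row_set_row_neq x i j v : j != i -> row j (set_row x i v) = row j x.
Proof. by move=> /negPf ji; apply/rowP => l; rewrite !mxE ji. Qed.

Lemma set_row_id x i : set_row x i (row i x) = x.
Proof. by apply/matrixP => k l; rewrite !mxE; case: eqP => [->|//]. Qed.

Lemma set_row_dist x i v w : `|set_row x i v - set_row x i w| <= `|v - w|.
Proof.
apply: ler_mx_norm => // k l; rewrite !mxE.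
case: eqP => _; last by rewrite subrr normr0.
by have := mx_norm_entry (v - w) ord0 l; rewrite !mxE.
Qed.

Lemma row_norm x i : `|row i x| <= `|x|.
Proof. by apply: ler_mx_norm => // k l; rewrite mxE; exact: mx_norm_entry. Qed.

Lemma row_continuous i : continuous (fun x => row i x).
Proof.
by apply: nonexpansive_continuous => x y; rewrite -raddfB; exact: row_norm.
Qed.

Lemma vec_mx_continuous :
  continuous (fun v : 'rV[R]_(n * d) => vec_mx v : 'M[R]_(n, d)).
Proof.
apply: nonexpansive_continuous => x y; rewrite -raddfB.
by apply: ler_mx_norm => // i j; rewrite mxE; exact: mx_norm_entry.
Qed.

(** The nonexpansive map [vec_mx] carries compactness of a closed ball over from row vectors, and
    [A] is a closed subset of the image. *)
Lemma bounded_closed_compact_mx (A : set 'M[R]_(n, d)) (M : R) :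
  (forall x, A x -> `|x| <= M) -> closed A -> compact A.
Proof.
move=> AM Acl.
pose B : set 'rV[R]_(n * d) := [set v | `|v| <= M].
have cB : compact B.
  apply: bounded_closed_compact.
    exists M; split; first exact: num_real.
    by move=> N MN v /= vM; rewrite (le_trans vM)// ltW.
  apply: (@preimage_closed _ _ (fun v : 'rV[R]_(n * d) => `|v|) [set r | r <= M]).
    by move=> v _; exact: norm_continuous.
  exact: closed_le.
have := continuous_compact (continuous_subspaceT vec_mx_continuous) cB.
move=> /(subclosed_compact Acl); apply => x Ax.
exists (mxvec x); last exact: mxvecK.
apply: le_trans (AM _ Ax); apply: ler_mx_norm => // i j.
rewrite (ord1 i); case/mxvec_indexP: j => k l.
rewrite mxvecE; exact: mx_norm_entry.
Qed.

End matrix_rows.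

(** * Lipschitz majorants by successive conjugation *)

Section lipschitz_majorant.
Context {R : realType} {n d : nat}.
Variables (C : 'M[R]_(n, d) -> R) (L : R).
Hypotheses (L0 : 0 <= L) (CL : lipschitz_with L C).
Implicit Types (D : 'I_n -> set 'rV[R]_d) (f : 'I_n -> 'rV[R]_d -> R).

(* [v] is the [C]-conjugate of the [f j], [j != i]. *)
Let step D f i : (forall j, D j !=set0) ->
  (forall x, (forall j, D j (row j x)) -> \sum_j f j (row j x) <= C x) ->
  exists v, [/\ lipschitz_with L v, (forall x, D i x -> f i x <= v x) &
    forall x, (forall j, j != i -> D j (row j x)) ->
      v (row i x) + \sum_(j | j != i) f j (row j x) <= C x].
Proof.
move=> D0 fC.
have [p pD] : exists p : 'M[R]_(n, d), forall j, D j (row j p).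
  have [q qD] := choice D0.
  by exists (\matrix_j q j) => j; rewrite rowK.
pose A : set 'M[R]_(n, d) := [set y | forall j, j != i -> D j (row j y)].
pose F (y : 'M[R]_(n, d)) (v : 'rV[R]_d) :=
  C (set_row y i v) - \sum_(j | j != i) f j (row j y).
have FD y v : A y -> D i v -> f i v <= F y v.
  move=> Ay Dv; rewrite lerBrDr.
  have := fC (set_row y i v); rewrite (bigD1 i)//= row_set_row.
  under eq_bigr => j ji do rewrite row_set_row_neq//.
  apply => j; have [->|ji] := eqVneq j i; first by rewrite row_set_row.
  by rewrite row_set_row_neq//; exact: Ay.
(* At [row i p], which lies in [D i], [FD] bounds the family below. *)
have [||y Ay|v [vL vF vM]] := @lipschitz_inf R _ _ A F L (row i p) (f i (row i p)).
- by exists p => j _.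
- move=> y Ay a b; rewrite /F opprB addrA subrK; apply: le_trans (CL _ _) _.
  by apply: ler_wpM2l => //; exact: set_row_dist.
- exact: FD.
exists v; split=> // [x Dx|x xD]; first by apply: vM => y Ay; exact: FD.
by rewrite -lerBrDr; have := vF x (row i x) xD; rewrite /F set_row_id.
Qed.

(** The components are conjugated in the order of their indices. The induction invariant is that,
    once the first [m] are done, the constraint holds without restriction on the first [m] rows. *)
Lemma lipschitz_majorant D f : (forall j, D j !=set0) ->
  (forall x, (forall j, D j (row j x)) -> \sum_j f j (row j x) <= C x) ->
  exists u, [/\ forall j, lipschitz_with L (u j),
    forall j x, D j x -> f j x <= u j x & forall x, \sum_j u j (row j x) <= C x].
Proof.
move=> D0 fC.
suff /(_ n)[//|u [uL uf uC]] : forall m, (m <= n)%N -> exists u,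
   [/\ forall j : 'I_n, (j < m)%N -> lipschitz_with L (u j),
    forall j x, D j x -> f j x <= u j x &
    forall x, (forall j : 'I_n, (m <= j)%N -> D j (row j x)) ->
      \sum_j u j (row j x) <= C x].
  exists u; split=> // [j|x]; first exact: uL.
  by apply: uC => j; rewrite leqNgt ltn_ord.
elim=> [_|m IH mn]; first by exists f; split=> // x xD; apply: fC => j; exact: xD.
have [u [uL uf uC]] := IH (ltnW mn).
pose i := Ordinal mn.
have [j|x xD|v [vL vu vC]] :=
    @step (fun j => if (j < m)%N then setT else D j) u i.
- by case: ifP => _ //; exists 0.
- by apply: uC => j mj; have := xD j; rewrite ltnNge mj.
exists (fun j => if j == i then v else u j); split.
- move=> j; have [->//|ji] := eqVneq j i.
  rewrite ltnS leq_eqVlt => /orP[/eqP jm|/uL//].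
  by case/eqP: ji; exact: val_inj.
- move=> j x Dx; case: eqP => [ji|_]; last exact: uf.
  rewrite -ji in vu; apply: le_trans (uf _ _ Dx) (vu _ _).
  by rewrite ji /= ltnn -ji.
- move=> x xD; rewrite (bigD1 i)//= eqxx.
  under eq_bigr => j /negPf ji do rewrite ji.
  apply: vC => j ji; case: ifPn => //; rewrite -leqNgt => mj; apply: xD.
  by rewrite ltn_neqAle mj andbT; apply: contra ji => /eqP mj'; apply/eqP/val_inj.
Qed.

End lipschitz_majorant.

(** * Common contact points *)

(** Near [t] the increments of [f] stay below those of [c] along [E], whose first-order term is
    ['D_E c x]. *)
Lemma derivable_supergradient (R : realType) (V : normedModType R) (c : V -> R)
    (x E : V) (f : R -> R) (t : R) : derivable c x E ->
  (\forall s \near t, f s - f t <= c ((s - t) *: E + x) - c x) ->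
  supergradient f t ('D_E c x).
Proof.
move=> cE fc e e0; near=> s.
have [->|st] := eqVneq s t; first by rewrite !subrr normr0 !mulr0 addr0.
have h0 : s - t != 0 by rewrite subr_eq0.
have dc : `|'D_E c x - (s - t)^-1 *: (c ((s - t) *: E + x) - c x)| <= e.
  move: h0; near: s.
  have : nbhs (0 : R) [set h : R | h != 0 ->
      `|'D_E c x - h^-1 *: (c (h *: E + x) - c x)| <= e].
    exact: (@cvgr_dist_le _ _ _ _ _ _ _ cE e e0).
  move=> /nbhs_ballP[r /= r0 rP].
  near=> s => h0; apply: (rP (s - t)) => //; rewrite /ball/= sub0r normrN.
  by near: s; apply: cvgr_distC_lt.
have fs : f s - f t <= c ((s - t) *: E + x) - c x by near: s.
apply: le_trans fs _; rewrite -lerBlDl.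
set q := c _ - c x in dc *.
rewrite (_ : q - 'D_E c x * (s - t) = ((s - t)^-1 *: q - 'D_E c x) * (s - t)); last first.
  by rewrite mulrBl /GRing.scale/= mulrAC mulVf// mul1r.
apply: le_trans (ler_norm _) _; rewrite normrM; apply: ler_wpM2r => //.
by rewrite distrC.
Unshelve. all: by end_near. Qed.

Lemma locally_const_connected (R : realType) (V : normedModType R) (U : set V)
    (h : V -> R) : open U -> connected U -> continuous h ->
  (forall x, U x -> \forall y \near x, h y = h x) ->
  forall x y, U x -> U y -> h y = h x.
Proof.
move=> oU cU hc hl x y Ux Uy.
suff : U `&` [set z | h z = h x] = U by move=> /seteqP[_ /(_ y Uy)[]].
apply: cU.
- by exists x.
- exists (U `&` [set z | h z = h x]); last by rewrite setIA setIid.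
  rewrite openE => z [Uz hz]; apply: filterI; first exact: open_nbhs_nbhs.
  by apply: filterS (hl z Uz) => z'; rewrite /= hz.
- exists [set z | h z = h x] => //.
  apply: (@preimage_closed _ _ h [set h x]); first by move=> z _; exact: hc.
  exact: closed_eq.
Qed.

(** The increments of [u] and [w] are both dominated by those of [c] when row [i] alone moves, so on
    a segment the directional derivative of [c] is a common supergradient. Segments in a ball around
    [v0] give local constancy. *)
Lemma common_contact_const (R : realType) (n d : nat) (c : 'M[R]_(n, d) -> R)
    (i : 'I_n) (U : set 'rV[R]_d) (u w : 'rV[R]_d -> R) :
  (forall x, differentiable c x) -> open U -> connected U ->
  continuous u -> continuous w ->
  (forall v, U v -> exists2 x, row i x = v & forall y, U y ->
     u y - u v <= c (set_row x i y) - c x /\ w y - w v <= c (set_row x i y) - c x) ->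
  forall x y, U x -> U y -> u y - w y = u x - w x.
Proof.
move=> cd oU cU uc wc contact.
apply: (@locally_const_connected _ _ U (fun x => u x - w x)) => //.
  by move=> x; apply: continuousB; [exact: uc|exact: wc].
move=> v0 Uv0.
have /nbhs_ballP[r /= r0 rU] : nbhs v0 U by exact: open_nbhs_nbhs.
apply/nbhs_ballP; exists r => //= y yr.
pose l (t : R) := v0 + t *: (y - v0).
have lc : continuous l.
  move=> t; apply: cvgD; first exact: cvg_cst.
  by apply: cvgZr_tmp; exact: cvg_id.
have lU t : 0 <= t <= 1 -> U (l t).
  move=> /andP[t0 t1]; apply: rU; rewrite -ball_normE/= opprD addNKr normrN normrZ.
  move: yr; rewrite -ball_normE/= distrC; apply: le_lt_trans.
  by rewrite ger0_norm// ler_piMl.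
have fc (f : 'rV[R]_d -> R) : continuous f -> continuous (f \o l).
  by move=> cf t; apply: continuous_comp; [exact: lc|exact: cf].
have sg t : 0 <= t <= 1 ->
    exists2 p, supergradient (u \o l) t p & supergradient (w \o l) t p.
  move=> t01; have [x xt xP] := contact _ (lU t t01).
  (* Moving row [i] along the segment is moving [x] along the fixed direction [E]. *)
  pose E := set_row (0 : 'M[R]_(n, d)) i (y - v0).
  have xE s : set_row x i (l s) = (s - t) *: E + x.
    apply/matrixP => k m; rewrite !mxE; case: eqP => [->|_]; last by rewrite mulr0 add0r.
    have /rowP/(_ m) := xt; rewrite !mxE => ->; lra.
  have dE : derivable c x E by apply: diff_derivable.
  have nU : \forall s \near t, U (l s).
    by apply: (lc t); apply: open_nbhs_nbhs; split => //; exact: lU.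
  by exists ('D_E c x); apply: derivable_supergradient => //;
    apply: filterS nU => s /xP[]; rewrite xE.
have l0 : l 0 = v0 by rewrite /l scale0r addr0.
have l1 : l 1 = y by rewrite /l scale1r addrC subrK.
(* Exchanging [u] and [w] gives the reverse inequality between the ends of the segment. *)
have := common_supergradient_le (fc _ uc) (fc _ wc) sg.
have := common_supergradient_le (fc _ wc) (fc _ uc).
rewrite /= l0 l1 => le1 le2; have le1' : w v0 - u v0 <= w y - u y.
  by apply: le1 => t /sg[p]; exists p.
lra.
Qed.

(** * Measures *)

Section full_measure_set.
Context (dT : measure_display) (T : measurableType dT) (R : realType).
Variables (P : probability T R) (U : set T).
Hypotheses (mU : measurable U) (PU : P U = 1%E).
Local Open Scope ereal_scope.

Lemma ae_full_set : {ae P, forall x, U x}.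
Proof.
exists (~` U); split; [exact: measurableC| |by []].
by rewrite probability_setC// PU subee.
Qed.

Lemma integral_full_set (f : T -> \bar R) : measurable_fun setT f ->
  \int[P]_x f x = \int[P]_(x in U) f x.
Proof.
move=> mf; rewrite [RHS]integral_mkcond; apply: ae_eq_integral => //.
  by apply/(measurable_restrictT _ mU); exact: measurable_funTS.
by apply: filterS ae_full_set => x Ux _; rewrite patchE mem_set.
Qed.

(** The value [-oo] makes a constraint known only for points of the sets [U] hold everywhere, and
    leaves integrals unchanged because [U] has full measure. *)
Definition extendNy (v : T -> R) (x : T) : \bar R :=
  if x \in U then (v x)%:E else -oo.

Lemma extendNyE v x : U x -> extendNy v x = (v x)%:E.
Proof. by move=> Ux; rewrite /extendNy mem_set. Qed.

Lemma extendNyN v x : ~ U x -> extendNy v x = -oo.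
Proof. by move=> Ux; rewrite /extendNy memNset. Qed.

Lemma extendNy_lty v x : extendNy v x < +oo.
Proof. by rewrite /extendNy; case: ifP => _; rewrite ?ltry ?ltNyy. Qed.

Lemma measurable_extendNy v : measurable_fun setT v -> measurable_fun setT (extendNy v).
Proof.
move=> mv; apply: measurable_fun_ifT; last exact: measurable_cst.
- apply: (measurable_fun_bool true); rewrite setTI (_ : _ @^-1` _ = U)//.
  by apply/seteqP; split=> x /=; [exact: set_mem | exact: mem_set].
- exact/measurable_EFinP.
Qed.

Lemma integral_extendNy v : measurable_fun setT v ->
  \int[P]_x extendNy v x = \int[P]_(x in U) (v x)%:E.
Proof.
move=> mv; rewrite integral_full_set; last exact: measurable_extendNy.
by apply: eq_integral => x /set_mem Ux; rewrite extendNyE.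
Qed.

Lemma integral_defined_extendNy v : measurable_fun setT v ->
  P.-integrable U (EFin \o v) -> integral_defined P (extendNy v).
Proof.
move=> mv iv; left; rewrite integral_full_set; last first.
  by apply: measurable_funepos; exact: measurable_extendNy.
rewrite (eq_integral (EFin \o v)^\+); first exact: integral_funepos_lt_pinfty.
by move=> x /set_mem Ux; rewrite !funeposE extendNyE.
Qed.

(** If the negative part had infinite integral, the positive part would have a finite one and the
    integral would be [-oo]. *)
Lemma integral_defined_neg (f : T -> \bar R) :
  integral_defined P f -> \int[P]_x f x != -oo -> \int[P]_x f^\- x < +oo.
Proof.
move=> [fp|//]; rewrite integralE.
have : 0 <= \int[P]_x f^\+ x by apply: integral_ge0.
have : 0 <= \int[P]_x f^\- x by apply: integral_ge0.
case: (\int[P]_x f^\- x) => [r| |]//= _; first by rewrite ltry.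
by case: (\int[P]_x f^\+ x) fp => [r| |].
Qed.

(** If [f] were [-oo] on all of [U], a set of mass 1, its negative part would have infinite
    integral. *)
Lemma integral_neg_ltNy (f : T -> \bar R) : measurable_fun setT f ->
  \int[P]_x f^\- x < +oo -> exists2 x, U x & f x != -oo.
Proof.
move=> mf fn; apply: contrapT => nf.
suff : \int[P]_x f^\- x = +oo by move=> fy; rewrite fy in fn.
rewrite integral_full_set; last exact: measurable_funeneg.
rewrite (eq_integral (cst +oo)); last first.
  move=> x /set_mem Ux; rewrite funenegE (_ : f x = -oo) ?maxye//.
  by apply/eqP/negPn/negP => fx; apply: nf; exists x.
by transitivity (+oo * P U); [exact: integral_cst | rewrite PU mule1].
Qed.

Lemma integrable_majorized (f : T -> \bar R) (u : T -> R) : measurable_fun setT f ->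
  \int[P]_x f^\- x < +oo -> P.-integrable U (EFin \o u) ->
  (forall x, U x -> f x <= (u x)%:E) -> P.-integrable U f.
Proof.
move=> mf fn iu fu.
have mfU : measurable_fun U f by exact: measurable_funTS.
apply/integrableP; split => //.
rewrite (eq_integral (f^\+ \+ f^\-)); last first.
  by move=> x _; exact: (congr1 (@^~ x) (fune_abse f)).
rewrite ge0_integralD//; [|exact: measurable_funepos|exact: measurable_funeneg].
apply: lte_add_pinfty; last first.
  by rewrite -integral_full_set//; exact: measurable_funeneg.
apply: le_lt_trans (integral_funepos_lt_pinfty mU iu).
apply: ge0_le_integral => //.
- exact: measurable_funepos.
- by case/integrableP: (integrable_funepos mU iu).
- by move=> x Ux; rewrite !funeposE ge_max !le_max fu//= lexx orbT.
Qed.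

(** The function [u - f] is nonnegative on [U] with integral 0, hence vanishes almost everywhere;
    this also rules out infinite values of [f] there. *)
Lemma integral_eq_ae (f : T -> \bar R) (u : T -> R) :
  P.-integrable U f -> P.-integrable U (EFin \o u) ->
  (forall x, U x -> f x <= (u x)%:E) ->
  \int[P]_(x in U) f x = \int[P]_(x in U) (u x)%:E ->
  {ae P, forall x, f x = (u x)%:E}.
Proof.
move=> fi ui fu fuE.
have di := integrableB mU ui fi.
have : \int[P]_(x in U) `|(u x)%:E - f x| = 0.
  rewrite (eq_integral (fun x => (u x)%:E - f x)); last first.
    by move=> x /set_mem Ux; rewrite gee0_abs// sube_ge0 ?orbT//; exact: fu.
  by rewrite integralB// fuE subee//; exact: integrable_fin_num.
move=> /ae_eq_integral_abs-/(_ mU).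
have md : measurable_fun U (fun x => (u x)%:E - f x) by case/integrableP: di.
move=> /(_ md); apply: filterS2 ae_full_set => x Ux /(_ Ux).
by case: (f x) => [r| |]//= [] /eqP; rewrite subr_eq0 => /eqP ->.
Qed.

End full_measure_set.

Lemma continuous_measurable_rV (R : realType) (d : nat) (v : 'rV[R]_d -> R) :
  continuous v -> measurable_fun setT v.
Proof.
move=> vc; apply: (measurability _ (RGenOpens.measurableE R)) => _ [_ [a [b ->] <-]].
by rewrite setTI; apply: open_measurable_rV; apply: open_comp => // x _; exact: vc.
Qed.

(** Balls of the sup norm are boxes, whose measure is a product of lengths [2 * r]. *)
Lemma lebesgue_rV_ball_gt0 (R : realType) (d : nat) (x : 'rV[R]_d) (r : R) :
  0 < r -> (0 < lebesgue_rV d (ball x r))%E.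
Proof.
move=> r0.
have -> : ball x r = [set v | forall i, ball (x ord0 i : R) r (v ord0 i)].
  apply/seteqP; split=> v /=; first by move=> [_ xv] i; exact: xv.
  by move=> xv; split=> // i j; rewrite (ord1 i).
rewrite (@lebesgue_rV_box R d (fun i => ball (x ord0 i : R) r)); last first.
  by move=> i; apply: open_measurable; exact: ball_open.
apply: (@big_ind _ (fun y : \bar R => 0 < y)%E) => //.
  by move=> a b a0 b0; rewrite mule_gt0.
move=> i _; rewrite lebesgue_measure_ball ?ltW// lte_fin.
by rewrite pmulrn_lgt0.
Qed.

(** If the ball had mass 0, the density would vanish Lebesgue-almost everywhere on it, and the ball
    would be Lebesgue null. *)
Lemma density_ball_gt0 (R : realType) (d : nat) (P : probability 'rV[R]_d R)
    (f : 'rV[R]_d -> R) (x : 'rV[R]_d) (r : R) : 0 < r ->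
  is_density P (lebesgue_rV d) f -> (forall y, ball x r y -> 0 < f y) ->
  (0 < P (ball x r))%E.
Proof.
move=> r0 [mf f0 Pf] fpos.
have mB : measurable (ball x r) by apply: open_measurable_rV; exact: ball_open.
rewrite lt_neqAle measure_ge0 andbT; apply/negP => /eqP P0.
have : (\int[lebesgue_rV d]_(y in ball x r) `|(f y)%:E| = 0)%E.
  rewrite P0 Pf//; apply: eq_integral => y _.
  by rewrite gee0_abs// lee_fin.
move=> /ae_eq_integral_abs-/(_ mB).
have mfB : measurable_fun (ball x r) (EFin \o f).
  by apply: measurable_funTS; exact/measurable_EFinP.
move=> /(_ mfB) [N [mN N0 sN]].
have : (lebesgue_rV d (ball x r) <= lebesgue_rV d N)%E.
  apply: le_measure; rewrite ?inE// => y By; apply: sN => /= /(_ By) [fy].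
  by have := fpos _ By; rewrite fy ltxx.
by rewrite N0 leNgt lebesgue_rV_ball_gt0.
Qed.

(** * Limits along ultrafilters *)

Lemma ultra_fmap (T U : Type) (F : set_system T) (f : T -> U) :
  UltraFilter F -> UltraFilter (f @ F).
Proof.
move=> FU; split; first exact: fmap_proper_filter.
move=> G GF FG; apply/seteqP; split=> // A GA.
have [//|FA] := in_ultra_setVsetC (f @^-1` A) FU.
have : G set0 by rewrite -(setICr A); apply: filterI => //; exact: FG.
by move/filter_not_empty.
Qed.

(** Compactness of [[-B, B]]; this takes the place of extracting diagonal subsequences. *)
Lemma ultra_bounded_cvg (R : realType) (T : Type) (F : set_system T) (f : T -> R) (B : R) :
  UltraFilter F -> (forall k, `|f k| <= B) -> exists l : R, f @ F --> l.
Proof.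
move=> FU fB; have := @segment_compact R (- B) B; rewrite compact_ultra.
have fFU : UltraFilter (f @ F) by exact: ultra_fmap.
move=> /(_ _ fFU)[|l [_ fl]]; last by exists l.
by apply: nearW => k /=; rewrite in_itv/= -ler_norml; exact: fB.
Qed.

(** Within distance [r] of [x] both [f k] and [g] vary by at most [e / 3]; compactness of [K] makes
    the choice of [k] uniform. *)
Lemma equilipschitz_uniform (R : realType) (V : normedModType R) (K : set V)
    (F : set_system nat) (f : nat -> V -> R) (g : V -> R) (L e : R) :
  Filter F -> 0 < e -> 0 <= L -> compact K -> (forall k, lipschitz_with L (f k)) ->
  lipschitz_with L g -> (forall x, f ^~ x @ F --> g x) ->
  \forall k \near F, forall x, K x -> `|f k x - g x| <= e.
Proof.
move=> FF e0 L0 /compact_near_coveringP cK fL gL fg.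
apply: (cK _ F (fun k x => `|f k x - g x| <= e)) => x _.
have L1 : 0 < L + 1 by rewrite ltr_wpDl.
have e3 : 0 < e / 3 by rewrite divr_gt0.
pose r := e / 3 / (L + 1).
have r0 : 0 < r by rewrite divr_gt0.
exists (ball x r, [set k | `|g x - f k x| <= e / 3]) => /=.
  split; first exact: nbhsx_ballx.
  exact: (@cvgr_dist_le _ _ _ _ _ _ _ (fg x)).
move=> [y k] /= [xy fk].
have Lxy : L * `|x - y| <= e / 3.
  move: xy; rewrite -ball_normE/= /r ltr_pdivlMr// => xy.
  have := normr_ge0 (x - y); nra.
have := le_trans (fL k x y) Lxy; have := le_trans (gL x y) Lxy; move: fk.
rewrite !ler_norml => /andP[? ?] /andP[? ?] /andP[? ?].
by apply/andP; split; lra.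
Qed.

(** * The dual problem *)

Section dual_potentials.
Context {R : realType} {n d : nat}.
Variables (c C : 'M[R]_(n, d) -> R) (L M : R) (mu : 'I_n -> probability 'rV[R]_d R).
Variables (O : 'I_n -> set 'rV[R]_d).
Hypotheses (n_gt0 : (0 < n)%N) (L0 : 0 <= L) (CL : lipschitz_with L C).
Hypothesis Cc : forall x, (forall i, closure (O i) (row i x)) -> C x = c x.
Hypothesis O_open : forall i, open (O i).
Hypothesis O_bounded : forall i x, O i x -> `|x| <= M.
Hypothesis mu_O : forall i, mu i (O i) = 1%E.
Implicit Types u v w : 'I_n -> 'rV[R]_d -> R.

Let mO i : measurable (O i). Proof. exact: open_measurable_rV. Qed.

Definition dual_value v : R := \sum_i \int[mu i]_(x in O i) v i x.

Definition bounded_measurable v : Prop := forall i,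
  measurable_fun setT (v i) /\ exists B, forall x, O i x -> `|v i x| <= B.

Definition admissible v : Prop := bounded_measurable v /\
  forall x, (forall i, O i (row i x)) -> \sum_i v i (row i x) <= c x.

(** Unlike in [admissible], the constraint is global and against the extension [C]; with the common
    constant [L], these conditions survive means and pointwise limits. *)
Definition potential u : Prop := (forall i, lipschitz_with L (u i)) /\
  forall x, \sum_i u i (row i x) <= C x.

Definition extend_tuple v i : 'rV[R]_d -> \bar R := extendNy (O i) (v i).

Lemma bounded_measurable_integrable v i : bounded_measurable v ->
  (mu i).-integrable (O i) (EFin \o v i).
Proof.
move=> /(_ i)[mv [B vB]]; apply: measurable_bounded_integrable => //.
- by rewrite -[X in (X < _)%E]/(mu i (O i)) mu_O ltry.
- exact: measurable_funTS.
- exists B; split; first exact: num_real.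
  by move=> N BN x Ox; exact: le_trans (vB x Ox) (ltW BN).
Qed.

Lemma EFin_dual_value v : bounded_measurable v ->
  (dual_value v)%:E = (\sum_i \int[mu i]_(x in O i) (v i x)%:E)%E.
Proof.
move=> vb; rewrite /dual_value -sumEFin; apply: eq_bigr => i _.
by rewrite fineK//; apply: integrable_fin_num => //; exact: bounded_measurable_integrable.
Qed.

(** As [O i] has mass 1, the constant [e i] integrates to itself. Used for upper bounds, shifts by
    constants and uniform convergence. *)
Lemma dual_value_le v w (e : 'I_n -> R) : bounded_measurable v -> bounded_measurable w ->
  (forall i x, O i x -> v i x <= w i x + e i) ->
  dual_value v <= dual_value w + \sum_i e i.
Proof.
move=> vb wb vw; rewrite /dual_value -big_split/=; apply: ler_sum => i _.
have ei : (mu i).-integrable (O i) (EFin \o cst (e i)).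
  by apply: finite_measure_integrable_cst.
have wi := bounded_measurable_integrable i wb.
have -> : e i = \int[mu i]_(x in O i) (cst (e i) x).
  rewrite Rintegral_cst// -[X in fine X]/(mu i (O i)).
  by rewrite mu_O/= mulr1.
rewrite -RintegralD//; apply: le_Rintegral => //.
- exact: bounded_measurable_integrable.
- apply: (eq_integrable _ ((EFin \o w i) \+ (EFin \o cst (e i)))%E) => //.
  exact: integrableD.
- exact: vw.
Qed.

Lemma dual_sum_extend v : bounded_measurable v ->
  dual_sum mu (extend_tuple v) = (dual_value v)%:E.
Proof.
move=> vb; rewrite EFin_dual_value//; apply: eq_bigr => i _.
by rewrite integral_extendNy//; case: (vb i).
Qed.

Lemma admissible_feasible v : admissible v -> DK_feasible c mu (extend_tuple v).
Proof.
move=> [vb vc]; split; split.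
- by move=> i; apply: measurable_extendNy => //; case: (vb i).
- by move=> i x; exact: extendNy_lty.
- move=> x; have [xO|/existsNP[i xi]] := pselect (forall i, O i (row i x)).
    rewrite (eq_bigr (fun i => (v i (row i x))%:E)); last first.
      by move=> i _; rewrite /extend_tuple extendNyE.
    by rewrite sumEFin lee_fin vc.
  (* A single term [-oo] makes the whole sum [-oo]. *)
  rewrite (_ : (\sum_(i < n) _)%E = -oo%E) ?leNye//; apply/esum_eqNyP.
  by exists i; rewrite /extend_tuple extendNyN// mem_index_enum.
- move=> i; have [mv _] := vb i; apply: integral_defined_extendNy => //.
  exact: bounded_measurable_integrable.
- move=> [i [j [+ _]]]; have [mv _] := vb i.
  rewrite integral_extendNy// => ioo.
  by have := integrable_fin_num (mO i) (bounded_measurable_integrable i vb);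
    rewrite ioo.
Qed.

Lemma admissible_le v : admissible v -> ((dual_value v)%:E <= DK_value c mu)%E.
Proof.
move=> va; apply: ereal_sup_ubound; exists (extend_tuple v).
  exact: admissible_feasible.
by apply: dual_sum_extend; case: va.
Qed.

Lemma admissible_solution v : admissible v -> (DK_value c mu <= (dual_value v)%:E)%E ->
  DK_solution c mu (extend_tuple v).
Proof.
move=> va Vv; split; first exact: admissible_feasible.
rewrite dual_sum_extend; last by case: va.
by apply/eqP; rewrite eq_le Vv andbT admissible_le.
Qed.

(** * Reduction to Lipschitz potentials *)

Lemma potential_oscillation u i x y : potential u -> O i x -> O i y ->
  u i x <= u i y + L * (M + M).
Proof.
move=> [uL _] Ox Oy; have := uL i x y; rewrite ler_norml => /andP[_].
have : L * `|x - y| <= L * (M + M).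
  apply: ler_wpM2l => //; apply: le_trans (ler_normB _ _) _.
  by rewrite lerD// (@O_bounded i).
lra.
Qed.

Lemma potential_admissible u : potential u -> admissible u.
Proof.
move=> up; split=> [i|x xO]; last first.
  rewrite -Cc; first by case: up.
  by move=> i; apply: subset_closure; exact: xO.
split.
  by apply: continuous_measurable_rV; apply: lipschitz_with_continuous; case: up => + _; exact.
have [[y Oy]|O0] := pselect (exists y, O i y); last first.
  by exists 0 => x Ox; case: O0; exists x.
exists (`|u i y| + L * (M + M)) => x Ox.
have h1 := potential_oscillation up Ox Oy; have h2 := potential_oscillation up Oy Ox.
have := ler_norm (u i y); have := lerNnormlW (lexx `|u i y|).
by rewrite ler_norml; move=> h3 h4; apply/andP; split; lra.
Qed.

(** Where they are finite, the [phi i] are real and satisfy the constraint for [C], so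
    [lipschitz_majorant] applies on these domains; elsewhere in [O i] any real function majorizes
    them. *)
Lemma feasible_potential phi : DK_feasible c mu phi -> dual_sum mu phi != -oo%E ->
  exists2 u, potential u & forall i,
    [/\ (forall x, O i x -> (phi i x <= (u i x)%:E)%E),
        (mu i).-integrable (O i) (phi i) &
        (\int[mu i]_x phi i x = \int[mu i]_(x in O i) phi i x)%E].
Proof.
move=> [[mphi phioo phic] [phid _]] phiNy.
have neg i : (\int[mu i]_x (phi i)^\- x < +oo)%E.
  apply: integral_defined_neg => //; apply: contra phiNy => /eqP phi_i.
  by apply/eqP/esum_eqNyP; exists i; rewrite mem_index_enum.
pose D i := O i `&` [set x | phi i x != -oo%E].
have D0 i : D i !=set0.
  have [x Ox px] := integral_neg_ltNy (mO i) (mu_O i) (mphi i) (neg i).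
  by exists x.
have fp i x : phi i x != -oo%E -> phi i x = (fine (phi i x))%:E.
  by move=> px; rewrite fineK// fin_numE px/= lt_eqF.
have [x xD|u [uL uphi uC]] :=
    @lipschitz_majorant R n d C L L0 CL D (fun i x => fine (phi i x)) D0.
  rewrite -lee_fin -sumEFin Cc; last first.
    by move=> i; apply: subset_closure; case: (xD i).
  apply: le_trans (phic x); apply: lee_sum => i _.
  by rewrite -fp//; case: (xD i).
exists u => // i.
have le_u x : O i x -> (phi i x <= (u i x)%:E)%E.
  move=> Ox; have [->|px] := eqVneq (phi i x) -oo%E; first by rewrite leNye.
  by rewrite fp// lee_fin uphi.
split=> //; last exact: integral_full_set.
apply: integrable_majorized le_u => //.
by apply: bounded_measurable_integrable; case: (potential_admissible (conj uL uC)).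
Qed.

(** * Finiteness of the value and existence of an optimal potential *)

Lemma O_nonempty i : O i !=set0.
Proof.
apply/set0P/eqP => O0; have := mu_O i; rewrite O0 measure0 => /eqP.
by rewrite eq_sym onee_eq0.
Qed.

(** The constants [C q / n] satisfy the constraint at the single point [q], so [lipschitz_majorant]
    applies with singletons as domains. This keeps the value above [-oo]. *)
Lemma potential_exists : exists u, potential u.
Proof.
have [p pO] := choice O_nonempty.
pose q : 'M[R]_(n, d) := \matrix_i p i.
have [|u [uL _ uC]] := @lipschitz_majorant R n d C L L0 CL (fun i => [set p i])
    (fun i _ => C q / n%:R) (fun i => ex_intro _ (p i) erefl).
  move=> x xp; have -> : x = q by apply/row_matrixP => i; rewrite rowK xp.
  rewrite sumr_const card_ord -[leLHS]mulr_natr.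
  by rewrite divfK// pnatr_eq0 -lt0n.
by exists u.
Qed.

Lemma dual_value_le_points u (p : 'I_n -> 'rV[R]_d) : potential u ->
  (forall i, O i (p i)) ->
  dual_value u <= \sum_i u i (p i) + \sum_(i < n) L * (M + M).
Proof.
move=> up pO; rewrite -big_split/=.
have zb : bounded_measurable (fun _ _ => 0).
  by move=> i; split; [exact: measurable_cst|exists 0 => x _; rewrite normr0].
have := @dual_value_le u (fun _ _ => 0) (fun i => u i (p i) + L * (M + M)).
rewrite {2}/dual_value big1 ?add0r; last first.
  by move=> i _; rewrite Rintegral_cst// mul0r.
apply => // [|i x Ox]; first by case: (potential_admissible up).
by rewrite add0r; exact: potential_oscillation.
Qed.

Lemma feasible_dual_sum_le phi u : potential u -> (forall i,
    [/\ (forall x, O i x -> (phi i x <= (u i x)%:E)%E),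
        (mu i).-integrable (O i) (phi i) &
        (\int[mu i]_x phi i x = \int[mu i]_(x in O i) phi i x)%E]) ->
  (dual_sum mu phi <= (dual_value u)%:E)%E.
Proof.
move=> up phiu; have [ub _] := potential_admissible up.
rewrite EFin_dual_value//; apply: lee_sum => i _; have [le_u phii ->] := phiu i.
apply: le_integral => //; first exact: bounded_measurable_integrable.
by move=> x /set_mem; exact: le_u.
Qed.

(** Any potential bounds the value below. Above, the values of a potential at fixed points [p i] sum
    to at most [C], and each component oscillates by at most [L * (M + M)] on [O i]. *)
Lemma DK_value_fin_num : DK_value c mu \is a fin_num.
Proof.
have [p pO] := choice O_nonempty.
rewrite fin_numElt; apply/andP; split.
  have [u up] := potential_exists.
  by apply: lt_le_trans (admissible_le (potential_admissible up)); rewrite ltNyr.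
pose B := C (\matrix_i p i) + \sum_(i < n) L * (M + M).
apply: (@le_lt_trans _ _ B%:E); last by rewrite ltry.
apply: ge_ereal_sup => _ [phi phif <-].
have [->|phiNy] := eqVneq (dual_sum mu phi) -oo%E; first by rewrite leNye.
have [u up phiu] := feasible_potential phif phiNy.
apply: le_trans (feasible_dual_sum_le up phiu) _; rewrite lee_fin.
apply: le_trans (dual_value_le_points up pO) _; rewrite lerD2r.
have [_ /(_ (\matrix_i p i))] := up.
by under eq_bigr do rewrite rowK.
Qed.

Lemma potential_shift u (a : 'I_n -> R) : potential u -> \sum_i a i = 0 ->
  potential (fun i x => u i x + a i) /\
  dual_value u <= dual_value (fun i x => u i x + a i).
Proof.
move=> up a0; have [uL uC] := up.
have sp : potential (fun i x => u i x + a i).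
  split=> [i x y|x]; first by rewrite opprD addrACA subrr addr0; exact: uL.
  by rewrite big_split/= a0 addr0.
split=> //; have [ub _] := potential_admissible up.
have [sb _] := potential_admissible sp.
have := @dual_value_le _ _ (fun i => - a i) ub sb; rewrite sumrN a0 oppr0 addr0.
by apply => i x _; rewrite addrK.
Qed.

(** Adding constants of sum 0 makes all the [u i (p i)] equal to their mean [s]. Their sum is at
    most [C q] by the constraint and at least [V - 1 - T] by near-optimality, whence [S]. *)
Lemma maximizing_potential (p : 'I_n -> 'rV[R]_d) : (forall i, O i (p i)) ->
  exists S, forall k : nat, exists u, [/\ potential u,
    fine (DK_value c mu) - k.+1%:R^-1 <= dual_value u &
    forall i, `|u i (p i)| <= S].
Proof.
move=> pO; set V := fine _.
pose q : 'M[R]_(n, d) := \matrix_i p i.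
pose T := \sum_(i < n) L * (M + M).
exists (`|C q| + `|V| + 1 + `|T|) => k.
have k0 : 0 < k.+1%:R^-1 :> R by rewrite invr_gt0.
have k1 : k.+1%:R^-1 <= 1 :> R by rewrite invf_le1// ler1n.
have [_ [phi phif <-]] := ub_ereal_sup_adherent k0 DK_value_fin_num.
rewrite -/(DK_value c mu) -(fineK DK_value_fin_num) -/V => Vphi.
have phiNy : dual_sum mu phi != -oo%E by rewrite gt_eqF// (lt_trans _ Vphi)// ltNyr.
have [u up phiu] := feasible_potential phif phiNy.
have Vu : V - k.+1%:R^-1 <= dual_value u.
  by rewrite -lee_fin; apply: le_trans (ltW Vphi) (feasible_dual_sum_le up phiu).
pose s := (\sum_i u i (p i)) / n%:R.
have ns : s * n%:R = \sum_i u i (p i) by rewrite divfK// pnatr_eq0 -lt0n.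
have a0 : \sum_i (s - u i (p i)) = 0.
  by rewrite sumrB sumr_const card_ord -mulr_natr ns subrr.
have [sp us] := potential_shift up a0.
exists (fun i x => u i x + (s - u i (p i))); split=> //; first exact: le_trans us.
move=> i; rewrite addrC subrK.
have n1 : 1 <= n%:R :> R by rewrite ler1n.
have sn : `|s| <= `|s * n%:R|.
  by rewrite [leRHS]normrM ler_peMr// (le_trans n1)// ler_norm.
apply: le_trans sn _; rewrite ns.
have h1 : \sum_i u i (p i) <= C q.
  by have [_ /(_ q)] := up; under eq_bigr do rewrite rowK.
have h2 := dual_value_le_points up pO; rewrite -/T in h2.
have := ler_norm (C q); have := ler_norm (- V); have := ler_norm T.
have := normr_ge0 (C q); have := normr_ge0 V; have := normr_ge0 T; rewrite normrN.
have Vu1 : V - 1 <= dual_value u by apply: le_trans Vu; rewrite lerD2l lerN2.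
by move=> *; rewrite ler_norml; apply/andP; split; lra.
Qed.

Lemma closure_O_bounded i x : closure (O i) x -> `|x| <= M.
Proof.
suff : closure (O i) `<=` [set y | `|y| <= M] by exact.
have cl : closed [set y : 'rV[R]_d | `|y| <= M].
  apply: (@preimage_closed _ _ (fun v : 'rV[R]_d => `|v|) [set r | r <= M]).
    by move=> v _; exact: norm_continuous.
  exact: closed_le.
by rewrite [X in _ `<=` X](closure_id _).1//; apply: closureS => y; exact: O_bounded.
Qed.

Lemma compact_closure_O i : compact (closure (O i)).
Proof.
apply: bounded_closed_compact; last exact: closed_closure.
exists M; split; first exact: num_real.
by move=> N MN x Ox; exact: le_trans (closure_O_bounded Ox) (ltW MN).
Qed.

Lemma optimal_potential_exists :
  exists2 u, potential u & (DK_value c mu <= (dual_value u)%:E)%E.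
Proof.
have [p pO] := choice O_nonempty.
have [S /choice[u uP]] := maximizing_potential pO.
(* Along one ultrafilter finer than the eventual filter, limits exist at all points at once. *)
have [F [FU ooF]] := ultraFilterLemma eventually_filter.
have FF : ProperFilter F by exact: ultra_proper.
have /choice[w wP] : forall i, exists w : 'rV[R]_d -> R,
    forall x, u k i x @[k --> F] --> w x.
  move=> i; suff /choice[f fP] : forall x, exists l : R, u k i x @[k --> F] --> l by exists f.
  move=> x.
  apply: (@ultra_bounded_cvg _ _ _ _ (S + L * `|x - p i|)) => // k.
  have [[uL _] _ /(_ i) uS] := uP k.
  rewrite -[u k i x](subrK (u k i (p i))) addrC (le_trans (ler_normD _ _))//.
  by apply: lerD => //; exact: uL.
have wL i : lipschitz_with L (w i).
  move=> x y; have f : `|u k i x - u k i y| @[k --> F] --> `|w i x - w i y|.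
    by apply: cvg_norm; apply: cvgB; exact: wP.
  apply: (@closed_cvg _ _ F _ _ [set r | r <= L * `|x - y|]) f.
    exact: closed_le.
  by apply: nearW => k; have [[+ _] _ _] := uP k; exact.
have wC x : \sum_i w i (row i x) <= C x.
  have f : \sum_i u k i (row i x) @[k --> F] --> \sum_i w i (row i x).
    by apply: (@cvg_big _ _ +%R) => [|i _]; [exact: add_continuous|exact: wP].
  apply: (@closed_cvg _ _ F _ _ [set r | r <= C x]) f.
    exact: closed_le.
  by apply: nearW => k; have [[_ +] _ _] := uP k; exact.
have wp : potential w by [].
exists w => //; rewrite -(fineK DK_value_fin_num) lee_fin; set V := fine _.
apply/ler_addgt0Pr => e e0.
(* The error is split into [n + 1] parts, one for each component and one for the near-optimality of
   [u k]. *)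
have e'0 : 0 < e / n.+1%:R by rewrite divr_gt0.
have near1 : \forall k \near F, forall i x, O i x -> `|u k i x - w i x| <= e / n.+1%:R.
  apply: filter_forall => i.
  have : \forall k \near F, forall x, closure (O i) x -> `|u k i x - w i x| <= e / n.+1%:R.
    apply: (@equilipschitz_uniform R _ _ F (fun k => u k i) (w i) L).
    - exact: e'0.
    - exact: L0.
    - exact: compact_closure_O.
    - by move=> k; have [[+ _] _ _] := uP k; exact.
    - exact: wL.
    - exact: wP.
  by apply: filterS => k kP x Ox; apply: kP; exact: subset_closure.
have near2 : \forall k \near F, k.+1%:R^-1 <= e / n.+1%:R :> R.
  apply: ooF; near=> k; apply: ltW; near: k; exact: near_infty_natSinv_lt (PosNum e'0).
have [k [uw ke]] := filter_ex (filterI near1 near2).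
have [up Vu _] := uP k.
have := @dual_value_le (u k) w (fun=> e / n.+1%:R).
have [ub _] := potential_admissible up; have [wb _] := potential_admissible wp.
move=> /(_ ub wb) H.
have {}H : dual_value (u k) <= dual_value w + e / n.+1%:R * n%:R.
  rewrite sumr_const card_ord -[_ *+ n]mulr_natr in H; apply: H => i x Ox.
  by have := uw i x Ox; rewrite ler_norml => /andP[_]; rewrite lerBlDl.
have E : e = e / n.+1%:R * n%:R + e / n.+1%:R.
  by rewrite -[X in _ + X]mulr1 -mulrDr natr1 divfK// pnatr_eq0.
have Vu1 : V - e / n.+1%:R <= dual_value (u k).
  by apply: le_trans Vu; rewrite lerD2l lerN2.
rewrite [X in _ + X]E addrA -lerBlDr; exact: le_trans Vu1 H.
Unshelve. all: by end_near. Qed.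

(** * Contact points and uniqueness *)

Hypothesis mu_ball_gt0 : forall i (x : 'rV[R]_d) (r : R),
  0 < r -> ball x r `<=` O i ->
  (0 < mu i (ball x r))%E.

(** The perturbed tuple leaves the Lipschitz class but stays bounded and measurable, so it can still
    be [admissible]. *)
Definition bump u i (A : set 'rV[R]_d) (h : R) j (x : 'rV[R]_d) : R :=
  u j x + (if j == i then h else 0) * \1_A x.

Lemma bump_bounded_measurable u i A h : measurable A ->
  bounded_measurable u -> bounded_measurable (bump u i A h).
Proof.
move=> mA ub j; have [mu_ [B uB]] := ub j; split.
  apply: measurable_funD => //; apply: measurable_funM; first exact: measurable_cst.
  exact: measurable_indic.
exists (B + `|h|) => x Ox; rewrite (le_trans (ler_normD _ _))// lerD ?uB//.
rewrite normrM; case: eqP => _; last by rewrite normr0 mul0r.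
by rewrite ler_piMr// indicE; case: (_ \in _); rewrite ?normr1 ?normr0.
Qed.

Lemma dual_value_bump_gt u i A h : bounded_measurable u -> measurable A -> 0 < h ->
  A `<=` O i -> (0 < mu i A)%E -> dual_value u < dual_value (bump u i A h).
Proof.
move=> ub mA h0 AO muA; rewrite /dual_value [ltLHS](bigD1 i)//= [ltRHS](bigD1 i)//=.
have -> : \sum_(j | j != i) \int[mu j]_(x in O j) bump u i A h j x =
    \sum_(j | j != i) \int[mu j]_(x in O j) u j x.
  apply: eq_bigr => j /negPf ji; apply: eq_Rintegral => x _.
  by rewrite /bump ji mul0r addr0.
rewrite ltrD2r /bump eqxx.
have ui := bounded_measurable_integrable i ub.
have Ii : (mu i).-integrable (O i) (EFin \o (\1_A : _ -> R)).
  apply: measurable_bounded_integrable => //.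
  - by rewrite -[X in (X < _)%E]/(mu i (O i)) mu_O ltry.
  - exists 1; split; first exact: num_real.
    move=> N N1 x _ /=; apply: le_trans (ltW N1).
    by rewrite indicE; case: (_ \in _); rewrite ?normr1 ?normr0.
rewrite RintegralD//; last first.
  apply: (eq_integrable _ (fun x => h%:E * (EFin \o \1_A) x)%E) => //.
  exact: integrableZl.
rewrite ltrDl RintegralZl// mulr_gt0// /Rintegral integral_indic//.
rewrite (setIidl AO) fine_gt0//; apply/andP; split; first exact: muA.
by rewrite (le_lt_trans (probability_le1 _ _))// ltry.
Qed.

(* If [C - \sum_j u j] were bounded below by [g > 0] on the fibre over [x0],
   raising [u i] by [g / 2] near [x0] would stay admissible and increase the value. *)
Lemma optimal_contact u i x0 : potential u ->
  (DK_value c mu <= (dual_value u)%:E)%E -> O i x0 ->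
  exists x, [/\ row i x = x0, forall j, closure (O j) (row j x) &
                \sum_j u j (row j x) = C x].
Proof.
move=> up uV Ox0; have [uL uC] := up.
have uc j : continuous (u j) by exact: lipschitz_with_continuous.
(* The fibre over [x0], taken in the closures so that the gap [g] attains its minimum. *)
pose K : set 'M[R]_(n, d) := [set x | row i x = x0] `&`
  [set x | forall j, closure (O j) (row j x)].
have Kc : compact K.
  apply: (@bounded_closed_compact_mx _ _ _ _ `|M|).
    move=> x [_ xO]; apply: ler_mx_norm => // j l.
    have := mx_norm_entry (row j x) ord0 l; rewrite mxE => /le_trans; apply.
    by rewrite (le_trans (closure_O_bounded (xO j)))// ler_norm.
  apply: closedI.
    apply: (@preimage_closed _ _ (fun x : 'M[R]_(n, d) => row i x) [set x0]).
      by move=> x _; exact: row_continuous.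
    by apply: accessible_closed_set1; apply: hausdorff_accessible; exact: norm_hausdorff.
  rewrite (_ : [set x | _] = \bigcap_(j in [set: 'I_n])
     ((fun x : 'M[R]_(n, d) => row j x) @^-1` closure (O j))); last first.
    by apply/seteqP; split=> x /= xO j; [move=> _; exact: xO|exact: (xO j)].
  apply: closed_bigI => j _; apply: preimage_closed; last exact: closed_closure.
  by move=> x _; exact: row_continuous.
have [p pO] := choice O_nonempty.
have K_set_row x : (forall j, O j (row j x)) -> K (set_row x i x0).
  move=> xO; split; first by rewrite /= row_set_row.
  move=> j; apply: subset_closure; have [->|ji] := eqVneq j i.
    by rewrite row_set_row.
  by rewrite row_set_row_neq.
have K0 : K !=set0.
  by exists (set_row (\matrix_j p j) i x0); apply: K_set_row => j; rewrite rowK.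
pose g x := C x - \sum_j u j (row j x).
have gc : continuous g.
  move=> x; apply: continuousB; first exact: lipschitz_with_continuous.
  apply: (@continuous_sumr _ _ _ (fun j x => u j (row j x))) => j y.
  by apply: continuous_comp; [exact: row_continuous|exact: uc].
have [x /set_mem[/= xi xO] xmin] := compact_EVT_min K0 Kc (continuous_subspaceT gc).
exists x; split=> //; apply/eqP; rewrite eq_le uC/= -subr_le0 -/(g x) leNgt.
apply/negP => gx0.
have /nbhs_ballP[r /= r0 rO] : nbhs x0 (O i) by exact: open_nbhs_nbhs.
(* While row [i] moves within distance [s] of [x0], [u i] and [C] each change by at most [g x / 4],
   so the gap stays at least [g x / 2], the height of the bump. *)
pose s := Num.min r (g x / (4 * (L + 1))).
have L1 : 0 < 4 * (L + 1) by rewrite mulr_gt0// ltr_wpDl.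
have s0 : 0 < s by rewrite lt_min r0 divr_gt0.
have sO : ball x0 s `<=` O i.
  by apply: subset_trans rO; apply: le_ball; rewrite ge_min lexx.
have Ls : L * s <= g x / 4.
  have : s <= g x / (4 * (L + 1)) by rewrite ge_min lexx orbT.
  by rewrite ler_pdivlMr//; nra.
have h0 : 0 < g x / 2 by rewrite divr_gt0.
have [ub _] := potential_admissible up.
have mB : measurable (ball x0 s : set 'rV[R]_d).
  by apply: open_measurable_rV; exact: ball_open.
have := dual_value_bump_gt ub mB h0 sO (mu_ball_gt0 s0 sO); rewrite ltNge -lee_fin => /negP; apply.
apply: le_trans uV; apply: admissible_le; split; first exact: bump_bounded_measurable.
move=> y yO; rewrite -Cc; last by move=> j; apply: subset_closure.
rewrite /bump big_split/= [X in _ + X](bigD1 i)//= eqxx.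
rewrite [X in _ + (_ + X)]big1 ?addr0; last by move=> j /negPf ->; rewrite mul0r.
rewrite indicE; case: (boolP (_ \in _)) => [/set_mem yB|_]; last first.
  by rewrite mulr0 addr0; exact: uC.
rewrite mulr1 (bigD1 i)//=.
(* Moving row [i] of [y] to [x0] lands in the fibre, where the gap is at least [g x]. *)
have /xmin : set_row y i x0 \in K by apply/mem_set/K_set_row.
rewrite {2}/g (bigD1 i)//= row_set_row.
under eq_bigr => j ji do rewrite row_set_row_neq//.
have yx : `|row i y - x0| <= s.
  by move: yB; rewrite -ball_normE/= distrC => /ltW.
have := CL (set_row y i x0) (set_row y i (row i y)); rewrite set_row_id.
have := uL i (row i y) x0.
have d1 : L * `|row i y - x0| <= g x / 4.
  by apply: le_trans Ls; exact: ler_wpM2l.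
have d2 : L * `|set_row y i x0 - y| <= g x / 4.
  apply: le_trans d1; apply: ler_wpM2l => //.
  by have := set_row_dist y i x0 (row i y); rewrite set_row_id (distrC x0).
move=> /le_trans/(_ d1); rewrite ler_norml => /andP[_ k1].
move=> /le_trans/(_ d2); rewrite ler_norml => /andP[_ k2].
move: k1 k2; set S := \sum_(_ | _) _; move: (g x) => G.
lra.
Qed.

(* A contact point of the mean of [u] and [w] is a contact point of both. *)
Lemma optimal_potential_unique u w :
  (forall x, differentiable c x) -> (forall i, connected (O i)) ->
  potential u -> potential w ->
  (DK_value c mu <= (dual_value u)%:E)%E -> (DK_value c mu <= (dual_value w)%:E)%E ->
  exists2 a : 'I_n -> R, \sum_i a i = 0 & forall i x, O i x -> w i x = u i x + a i.
Proof.
move=> cd Oc up wp uV wV.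
have [ub _] := potential_admissible up; have [wb _] := potential_admissible wp.
have [uL uC] := up; have [wL wC] := wp.
pose chi i x := 2^-1 * u i x + 2^-1 * w i x.
have chip : potential chi.
  split=> [i x y|x].
    have := uL i x y; have := wL i x y; rewrite /chi !ler_norml.
    by move=> /andP[? ?] /andP[? ?]; apply/andP; split; lra.
  rewrite big_split/= -!mulr_sumr; have := uC x; have := wC x; lra.
have [chib _] := potential_admissible chip.
have DVE : (dual_value chi)%:E = (2^-1 * dual_value u + 2^-1 * dual_value w)%:E.
  congr EFin; rewrite /dual_value !mulr_sumr -big_split/=; apply: eq_bigr => i _.
  have iu := bounded_measurable_integrable i ub.
  have iw := bounded_measurable_integrable i wb.
  rewrite -!RintegralZl// -RintegralD//.
  - apply: (eq_integrable _ (fun x => (2^-1)%:E * (EFin \o u i) x)%E) => //.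
    exact: integrableZl.
  - apply: (eq_integrable _ (fun x => (2^-1)%:E * (EFin \o w i) x)%E) => //.
    exact: integrableZl.
have chiV : (DK_value c mu <= (dual_value chi)%:E)%E.
  rewrite DVE; move: uV wV; rewrite -(fineK DK_value_fin_num) !lee_fin; lra.
have cst i x y : O i x -> O i y -> u i y - w i y = u i x - w i x.
  apply: (@common_contact_const _ _ _ c i (O i)) => //.
  - exact: lipschitz_with_continuous.
  - exact: lipschitz_with_continuous.
  move=> z Oz; have [q [qi qO qC]] := optimal_contact chip chiV Oz.
  exists q => // t Ot.
  (* Both sums are at most [C q] and their mean equals it, so both equal it. *)
  have : 2^-1 * (\sum_j u j (row j q)) + 2^-1 * (\sum_j w j (row j q)) = C q.
    by rewrite -qC /chi big_split/= !mulr_sumr.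
  (* All rows stay in the closures of the [O j], so the contact inequalities pass from [C] to the
     differentiable [c]. *)
  have Cq : C q = c q by exact: Cc.
  have Ct : C (set_row q i t) = c (set_row q i t).
    apply: Cc => j; have [->|ji] := eqVneq j i.
      by rewrite row_set_row; exact: subset_closure.
    by rewrite row_set_row_neq.
  have := uC q; have := wC q; have := uC (set_row q i t); have := wC (set_row q i t).
  rewrite ![\sum_j _](bigD1 i)//= row_set_row qi Cq Ct.
  rewrite (eq_bigr (fun j => w j (row j q))); last first.
    by move=> j ji; rewrite row_set_row_neq.
  rewrite [in X in _ -> X -> _](eq_bigr (fun j => u j (row j q))); last first.
    by move=> j ji; rewrite row_set_row_neq.
  move=> h1 h2 h3 h4 h5; split; lra.
have [p pO] := choice O_nonempty.
have wu i x : O i x -> w i x = u i x + (w i (p i) - u i (p i)).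
  by move=> Ox; have := cst i _ _ (pO i) Ox; lra.
exists (fun i => w i (p i) - u i (p i)) => //.
(* The values of [u] and [w] coincide, so comparing them both ways bounds the sum of the constants
   by 0 from each side. *)
have h1 : dual_value w <= dual_value u + \sum_i (w i (p i) - u i (p i)).
  by apply: dual_value_le => // i x Ox; rewrite -wu.
have h2 : dual_value u <= dual_value w + \sum_i (u i (p i) - w i (p i)).
  by apply: dual_value_le => // i x Ox; rewrite wu//; lra.
have := le_trans (admissible_le (potential_admissible up)) wV.
have := le_trans (admissible_le (potential_admissible wp)) uV.
rewrite !lee_fin; move: h1 h2; rewrite !sumrB; lra.
Qed.

(** Each integral of [phi i] is at most that of [u i], and by optimality the totals agree; so each
    pair of integrals agrees and [integral_eq_ae] applies. *)
Lemma solution_potential phi : DK_solution c mu phi ->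
  exists u, [/\ potential u, (DK_value c mu <= (dual_value u)%:E)%E &
    forall i, {ae mu i, forall x, phi i x = (u i x)%:E}].
Proof.
move=> [phif phiV].
have phiNy : dual_sum mu phi != -oo%E.
  by rewrite phiV; have := DK_value_fin_num; rewrite fin_numE => /andP[].
have [u up phiu] := feasible_potential phif phiNy.
have uV : (DK_value c mu <= (dual_value u)%:E)%E.
  by rewrite -phiV; exact: feasible_dual_sum_le.
exists u; split=> //.
have [ub _] := potential_admissible up.
have fin i : (\int[mu i]_(x in O i) phi i x)%E \is a fin_num.
  by apply: integrable_fin_num => //; case: (phiu i).
pose F i := fine (\int[mu i]_(x in O i) phi i x)%E.
have Fu i : F i <= \int[mu i]_(x in O i) u i x.
  have [le_u phii _] := phiu i; have ui := bounded_measurable_integrable i ub.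
  apply: fine_le => //; first exact: integrable_fin_num.
  by apply: le_integral => // x /set_mem; exact: le_u.
have sumF : \sum_i (\int[mu i]_(x in O i) u i x - F i) <= 0.
  rewrite sumrB subr_le0 -/(dual_value u) -lee_fin.
  apply: le_trans (admissible_le (potential_admissible up)) _.
  rewrite -phiV -sumEFin; apply: lee_sum => i _.
  by have [_ _ ->] := phiu i; rewrite fineK.
move=> i; have [le_u phii _] := phiu i.
apply: (integral_eq_ae (mO i) (mu_O i) phii) => //.
  exact: bounded_measurable_integrable.
have d0 j : 0 <= \int[mu j]_(x in O j) u j x - F j by rewrite subr_ge0.
have /eqP/psumr_eq0P z : \sum_i (\int[mu i]_(x in O i) u i x - F i) == 0.
  by rewrite eq_le sumF sumr_ge0.
have /eqP := z (fun j _ => d0 j) i isT; rewrite subr_eq0 => /eqP e.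
rewrite -(fineK (fin i)) -/(F i) -e fineK//.
by apply: integrable_fin_num => //; exact: bounded_measurable_integrable.
Qed.

End dual_potentials.

Theorem proposition1p1 (R : realType) (n d : nat) (n_gt0 : (0 < n)%N)
    (c : 'M[R]_(n, d) -> R) (mu : 'I_n -> probability 'rV[R]_d R)
    (O : 'I_n -> set 'rV[R]_d)
    (c_diff : forall x, differentiable c x)
    (c_lip : locally_lipschitz c)
    (O_open : forall i, open (O i))
    (O_connected : forall i, connected (O i))
    (O_bounded : forall i, bounded_set (O i))
    (mu_O : forall i, mu i (O i) = 1%E)
    (mu_boundary : forall i, mu i (boundary (O i)) = 0%E)
    (mu_ac : forall i, mu i `<< lebesgue_rV d)
    (mu_density : forall i, exists2 f : 'rV[R]_d -> R,
       is_density (mu i) (lebesgue_rV d) f & forall x, O i x -> 0 < f x) :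
  (exists phi, DK_solution c mu phi) /\
  (forall phi psi, DK_solution c mu phi -> DK_solution c mu psi ->
     exists2 a : 'I_n -> R, \sum_(i < n) a i = 0 &
       forall i, {ae mu i, forall x, psi i x = (phi i x + (a i)%:E)%E}).
Proof.
have [M0 MP] : exists M : R, forall i x, O i x -> `|x| <= M.
  have /choice[B BP] : forall i, exists B : R, forall x, O i x -> `|x| <= B.
    by move=> i; have [B [_ BP]] := O_bounded i; exists (B + 1) => x;
      apply: BP; rewrite ltrDl.
  exists (\big[Num.max/0]_i B i) => i x Ox; apply: le_trans (BP i x Ox) _.
  exact: le_bigmax.
(* A closed ball containing every tuple with rows in the closures of the [O i]; the absolute value
   ensures that it contains 0. *)
pose K : set 'M[R]_(n, d) := [set x | `|x| <= `|M0|].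
have Kc : compact K.
  apply: (@bounded_closed_compact_mx _ _ _ _ `|M0|) => //.
  apply: (@preimage_closed _ _ (fun x : 'M[R]_(n, d) => `|x|) [set r | r <= `|M0|]).
    by move=> v _; exact: norm_continuous.
  exact: closed_le.
have cc : continuous c by move=> x; exact: differentiable_continuous.
have [L L0 cL] := locally_lipschitz_compact c_lip cc Kc.
have K0 : K !=set0 by exists 0; rewrite /K/= normr0.
have [C CL CK] := lipschitz_extension K0 L0 cL.
have Cc x : (forall i, closure (O i) (row i x)) -> C x = c x.
  move=> xO; apply: CK; apply: ler_mx_norm => // j l.
  have := mx_norm_entry (row j x) ord0 l; rewrite mxE => /le_trans; apply.
  by rewrite (le_trans (closure_O_bounded MP (xO j)))// ler_norm.
have ball0 i (x : 'rV[R]_d) (r : R) : 0 < r -> ball x r `<=` O i ->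
    (0 < mu i (ball x r))%E.
  move=> r0 rO; have [f fd fpos] := mu_density i.
  by apply: density_ball_gt0 fd _ => // y /rO; exact: fpos.
split.
  have [u up uV] := optimal_potential_exists n_gt0 L0 CL Cc O_open MP mu_O.
  exists (extend_tuple O u).
  apply: admissible_solution => //.
  exact: (potential_admissible L0 Cc MP up).
move=> phi psi phis psis.
have [u [up uV phiu]] := solution_potential n_gt0 L0 CL Cc O_open MP mu_O phis.
have [w [wp wV psiw]] := solution_potential n_gt0 L0 CL Cc O_open MP mu_O psis.
have [a a0 wu] := optimal_potential_unique n_gt0 L0 CL Cc O_open MP mu_O ball0
  c_diff O_connected up wp uV wV.
exists a => // i.
have mO : measurable (O i) by exact: open_measurable_rV.
apply: filterS3 (phiu i) (psiw i) (ae_full_set mO (mu_O i)) => x -> -> Ox.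
by rewrite wu.
Qed.
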